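(* For every $i\in\mathbb{N}$ there exists a one-way nondeterministic nonerasing stack automaton $A_i$ with $L(A_i)=L(x_i)$, where $x_i$ is Larsen's rewb defined below. In particular each $L(x_i)$ is a nonerasing stack language.
   Context: Alphabet $\Sigma=\{a_j^l,a_j^m,a_j^r : j\in\mathbb{N}\}$ (for fixed $i$ only the finitely many letters with $j\le i$ occur). Larsen's rewbs: $x_0=(a_0^la_0^ma_0^r)^\ast$ and $x_{i+1}=\big(a_{i+1}^l\,(_i\,x_i\,)_i\,a_{i+1}^m\,\backslash i\,a_{i+1}^r\big)^\ast$ for $i\ge0$ (capture labels are natural numbers $0,\dots,i-1$). Rewb semantics: with bracket symbols $[_j,]_j$ and number symbols $j$ for each label, $\mathcal{R}(x)$ is the regular language obtained by reading $x$ as a regular expression with $\backslash j$ as the letter $j$ and $(_j\beta)_j$ as $[_j\,\mathcal{R}(\beta)\,]_j$. Dereferencing: repeatedly take the leftmost number symbol $j$; if no $[_j$ lies to its left delete it; else take the nearest $[_j$ to its left; if no $]_j$ lies between them the result is undefined; else replace this $j$ by the string strictly between that $[_j$ and the first subsequent $]_j$ with all brackets erased; finally delete all brackets. $L(x)$ is the set of dereferenced strings of $\mathcal{R}(x)$. Stack automaton (SA): nondeterministic finite control, one-way read-only input, stack over $\Gamma$ with initial symbol $Z_0$ between bottom marker $\#$ and top marker $\$$; a pointer moves left/right reading symbols anywhere; only at the top symbol $Z$ may the machine replace $Z$ by $w\in\Gamma^\ast$; acceptance by final state after consuming the input. A nonerasing stack automaton is an SA in which every top replacement has the form $Z\mapsto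 Zw$ with $w\in\Gamma^\ast$. *)

(* Defs.v *)
From HB Require Import structures.
From Stdlib Require List.
From mathcomp Require Import all_boot.
Set Implicit Arguments.
Unset Strict Implicit.
Unset Printing Implicit Defensive.

(* A letter a_j^t is encoded as the pair (j, t) with t : 'I_3,
   t = 0 for l, t = 1 for m, t = 2 for r. *)
Definition letter := (nat * 'I_3)%type.
Definition tl : 'I_3 := @Ordinal 3 0 isT.
Definition tm : 'I_3 := @Ordinal 3 1 isT.
Definition tr : 'I_3 := @Ordinal 3 2 isT.
Definition a_l (j : nat) : letter := (j, tl).
Definition a_m (j : nat) : letter := (j, tm).
Definition a_r (j : nat) : letter := (j, tr).

Inductive rewb : Type :=
  | RChar of letter
  | REps
  | REmpty
  | RCat of rewb & rewb
  | RAlt of rewb & rewb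
  | RStar of rewb
  | RCap of nat & rewb
  | RRef of nat.

Inductive ext : Type :=
  | XChr of letter
  | XOpen of nat
  | XClose of nat
  | XNum of nat.

Definition lang (T : Type) := seq T -> Prop.

Inductive star_lang (T : Type) (L : lang T) : lang T :=
  | star_nil : star_lang L [::]
  | star_cons u v : L u -> star_lang L v -> star_lang L (u ++ v).

Fixpoint Rlang (x : rewb) : lang ext :=
  match x with
  | RChar a => fun s => s = [:: XChr a]
  | REps => fun s => s = [::]
  | REmpty => fun _ => False
  | RCat y z => fun s => exists u v, s = u ++ v /\ Rlang y u /\ Rlang z v
  | RAlt y z => fun s => Rlang y s \/ Rlang z s
  | RStar y => star_lang (Rlang y)
  | RCap j y => fun s => exists u, s = XOpen j :: u ++ [:: XClose j] /\ Rlang y u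
  | RRef j => fun s => s = [:: XNum j]
  end.

Definition is_open (j : nat) (e : ext) : bool :=
  if e is XOpen k then k == j else false.
Definition is_close (j : nat) (e : ext) : bool :=
  if e is XClose k then k == j else false.

(* erase all brackets (applied only to strings without number symbols) *)
Definition letters_of (s : seq ext) : seq letter :=
  pmap (fun e => if e is XChr a then Some a else None) s.

(* Dereferencing, processed left to right.  [pre] is the already processed
   part (it contains no number symbols), [rest] the unprocessed part; the
   first number symbol of [rest] is the leftmost number symbol of the
   current string.  [None] means "undefined". *)
Fixpoint deref_aux (pre rest : seq ext) : option (seq letter) :=
  match rest with
  | [::] => Some (letters_of pre)
  | XNum j :: rest' =>
      let r := rev pre in
      let k := find (is_open j) r in
      if k == size r then deref_aux pre rest'
      else
        let seg := rev (take k r) in   (* what lies strictly right of the nearest [_j *)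
        let c := find (is_close j) seg in
        if c == size seg then None
        else deref_aux (pre ++ map XChr (letters_of (take c seg))) rest'
  | e :: rest' => deref_aux (rcons pre e) rest'
  end.

Definition deref (s : seq ext) : option (seq letter) := deref_aux [::] s.

Definition Lrewb (x : rewb) : lang letter :=
  fun w => exists s, Rlang x s /\ deref s = Some w.

Fixpoint larsen (i : nat) : rewb :=
  match i with
  | 0 => RStar (RCat (RChar (a_l 0)) (RCat (RChar (a_m 0)) (RChar (a_r 0))))
  | i'.+1 =>
      RStar (RCat (RChar (a_l i))
            (RCat (RCap i' (larsen i'))
            (RCat (RChar (a_m i))
            (RCat (RRef i') (RChar (a_r i))))))
  end.

Inductive stsym (G : Type) : Type := SBot | SSym of G | STop.
Arguments SBot {G}. Arguments STop {G}.

Inductive saction (G : Type) : Type :=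
  | MoveL | MoveR | Stay | Repl of seq G.
Arguments MoveL {G}. Arguments MoveR {G}. Arguments Stay {G}.

Record stack_automaton (S : finType) := SA {
  sa_Q : finType;
  sa_G : finType;
  sa_q0 : sa_Q;
  sa_Z0 : sa_G;
  sa_final : pred sa_Q;
  sa_delta : sa_Q -> option S -> stsym sa_G -> seq (sa_Q * saction sa_G)
}.

(* Stack s (bottom to top); pointer positions: 0 = #, 1..size s = symbols,
   (size s).+1 = $. *)
Definition read_at (G : Type) (s : seq G) (p : nat) : option (stsym G) :=
  if p == 0 then Some SBot
  else if p == (size s).+1 then Some STop
  else if onth s p.-1 is Some z then Some (SSym z) else None.

(* Replacement only when the pointer is on the top symbol; afterwards the
   pointer is on the new top (or on # if the stack became empty). *)
Definition apply_action (G : Type) (s : seq G) (p : nat) (act : saction G)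
  : option (seq G * nat) :=
  match act with
  | MoveL => if 0 < p then Some (s, p.-1) else None
  | MoveR => if p <= size s then Some (s, p.+1) else None
  | Stay => Some (s, p)
  | Repl w => if (p == size s) && (0 < p)
              then Some (take p.-1 s ++ w, size (take p.-1 s ++ w)) else None
  end.

Definition consume (S : Type) (a : option S) (w w' : seq S) : Prop :=
  match a with None => w' = w | Some x => w = x :: w' end.

Section SASemantics.
Variables (S : finType) (A : stack_automaton S).

Definition sa_config := (@sa_Q S A * seq S * seq (@sa_G S A) * nat)%type.

Inductive sa_step : sa_config -> sa_config -> Prop :=
  | SAStep q w s p a X q' act w' s' p' :
      read_at s p = Some X ->
      List.In (q', act) (@sa_delta S A q a X) ->
      consume a w w' ->
      apply_action s p act = Some (s', p') ->
      sa_step (q, w, s, p) (q', w', s', p').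

Inductive sa_reach : sa_config -> sa_config -> Prop :=
  | sa_refl c : sa_reach c c
  | sa_trans c1 c2 c3 : sa_step c1 c2 -> sa_reach c2 c3 -> sa_reach c1 c3.

Definition sa_accepts (w : seq S) : Prop :=
  exists qf s p,
    sa_reach (@sa_q0 S A, w, [:: @sa_Z0 S A], 1) (qf, [::], s, p) /\ @sa_final S A qf.

Definition nonerasing : Prop :=
  forall q a Z q' w, List.In (q', Repl w) (@sa_delta S A q a (SSym Z)) ->
    exists w', w = Z :: w'.
End SASemantics.

Definition Sigma_le (i : nat) : finType := ('I_i.+1 * 'I_3)%type.
Definition emb_letter (i : nat) (c : Sigma_le i) : letter := (val c.1, c.2).

(* Main.v *)
(* Unfolding the references, L(x_i) is obtained from {eps} by applying, for
   j = 0, ..., i, the operator K |-> { a_j^l u a_j^m u a_j^r : u in K }*.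
   The automaton first guesses on its stack, without reading input, the word
   with every second copy of u (and a_j^r) left out, that is, a bracket word
   over pairs of brackets of levels 0, ..., i.  It then rewinds and traverses
   this bracket word, walking over the content of each pair of brackets twice.
   One bit per level, telling whether the current pair of that level is being
   traversed for the second time, suffices, because the pairs enclosing a given
   position have distinct levels.  Nothing is ever erased. *)
From HB Require Import structures.
Require Import Defs.
From mathcomp Require Import all_boot.
Set Implicit Arguments.
Unset Strict Implicit.
Unset Printing Implicit Defensive.

(** * Dereferencing and the language of [larsen i] *)

Inductive larsen_word : nat -> seq letter -> Prop :=
  | larsen_word_nil n : larsen_word n [::]
  | larsen_word_cons n u v : larsen_word n u -> larsen_word n.+1 v ->
      larsen_word n.+1 (a_l n :: u ++ a_m n :: u ++ a_r n :: v).

Definition label_lt (i : nat) (e : ext) : bool :=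
  match e with XOpen k | XClose k => k < i | _ => true end.

(** [t] keeps its brackets, since later references search the processed prefix for them. The label
    bound ensures that a reference [i] placed after [t] meets no bracket of its own label inside
    [t]. *)
Definition derefs_to (i : nat) (s t : seq ext) : Prop :=
  (forall pre rest, deref_aux pre (s ++ rest) = deref_aux (pre ++ t) rest)
  /\ all (label_lt i) t.

Lemma derefs_to_nil i : derefs_to i [::] [::].
Proof. by split=> // pre rest; rewrite cats0. Qed.

Lemma derefs_to_cat i s1 t1 s2 t2 :
  derefs_to i s1 t1 -> derefs_to i s2 t2 -> derefs_to i (s1 ++ s2) (t1 ++ t2).
Proof.
move=> [d1 l1] [d2 l2]; split; last by rewrite all_cat l1.
by move=> pre rest; rewrite -catA d1 d2 catA.
Qed.

Lemma letters_of_cat s t : letters_of (s ++ t) = letters_of s ++ letters_of t.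
Proof. exact: pmap_cat. Qed.

Lemma letters_of_XChr u : letters_of (map XChr u) = u.
Proof. by elim: u => //= a u ->. Qed.

Lemma find_cat_cons (T : Type) (a : pred T) s x t :
  ~~ has a s -> a x -> find a (s ++ x :: t) = size s.
Proof. by move=> /negbTE as_ ax; rewrite find_cat as_ /= ax addn0. Qed.

(** One iteration of the star in [larsen i.+1]; [block_deref] is its counterpart after
    dereferencing, brackets still present. *)
Definition block (i : nat) (s : seq ext) : seq ext :=
  XChr (a_l i.+1) :: XOpen i ::
    s ++ [:: XClose i; XChr (a_m i.+1); XNum i; XChr (a_r i.+1)].

Definition block_deref (i : nat) (t : seq ext) : seq ext :=
  XChr (a_l i.+1) :: XOpen i ::
    t ++ [:: XClose i, XChr (a_m i.+1)
           & map XChr (letters_of t) ++ [:: XChr (a_r i.+1)]].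

(** All labels in [t] are below [i]. So, seen from the reference, the nearest opening bracket [i] is
    the one of the block, and the first closing bracket [i] after it is the one right after [t]:
    exactly the letters of [t] are copied. *)
Lemma derefs_to_block i s t :
  derefs_to i s t -> derefs_to i.+1 (block i s) (block_deref i t).
Proof.
move=> [ds lt]; split; last first.
  rewrite /= ltnSn /= all_cat /= ltnSn all_cat /= andbT; apply/andP; split.
    by apply: sub_all lt => -[] //= k /ltnW.
  by rewrite all_map (@eq_all _ _ predT) ?all_predT.
have no_open : ~~ has (is_open i) t.
  by rewrite -all_predC; apply: sub_all lt => -[] //= k /ltn_eqF ->.
have no_close : ~~ has (is_close i) t.
  by rewrite -all_predC; apply: sub_all lt => -[] //= k /ltn_eqF ->.
move=> pre rest; rewrite /block /= -catA ds /=.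
set p := rcons (rcons _ _) _.
have -> : rev p = (XChr (a_m i.+1) :: XClose i :: rev t)
                  ++ XOpen i :: XChr (a_l i.+1) :: rev pre.
  by rewrite /p !rev_rcons rev_cat !rev_rcons.
rewrite find_cat_cons /= ?eqxx ?has_rev //.
rewrite size_cat /= size_rev.
(* The opening bracket is found, hence the reference is not deleted. *)
rewrite ifN; last by rewrite -[X in X == _]addn0 eqn_add2l.
rewrite take_size_cat ?size_rev // !rev_cons revK -!cats1 -!catA /=.
rewrite find_cat_cons /= ?eqxx // ifN.
  by rewrite take_size_cat // /p -!cats1 -!catA.
by rewrite size_rev -[X in X == _]addn0 -addn2 eqn_add2l.
Qed.

Lemma letters_of_block_deref i t :
  letters_of (block_deref i t) =
  a_l i.+1 :: letters_of t ++ a_m i.+1 :: letters_of t ++ [:: a_r i.+1].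
Proof. by rewrite /= !letters_of_cat /= letters_of_cat letters_of_XChr. Qed.

Lemma larsen_word0 v : larsen_word 0 v -> v = [::].
Proof. by move=> H; inversion H. Qed.

Lemma larsen_word_cat_block n u v :
  larsen_word n u -> larsen_word n.+1 v ->
  larsen_word n.+1 ((a_l n :: u ++ a_m n :: u ++ [:: a_r n]) ++ v).
Proof.
move=> Hu Hv; have := larsen_word_cons Hu Hv.
by rewrite /= -!catA /= -!catA.
Qed.

Lemma Rlang_larsen_sound i s : Rlang (larsen i) s ->
  exists2 t, derefs_to i s t & larsen_word i.+1 (letters_of t).
Proof.
elim: i s => [|i IH] s /=.
  elim=> [|u v [_ [_ [-> [-> [_ [_ [-> [-> ->]]]]]]]] _ [t dt wt]].
    by exists [::]; [exact: derefs_to_nil | constructor].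
  exists ([:: XChr (a_l 0); XChr (a_m 0); XChr (a_r 0)] ++ t).
    apply: derefs_to_cat dt; split=> // pre rest /=.
    by rewrite -!cats1 -!catA.
  exact: (larsen_word_cons (larsen_word_nil 0) wt).
elim=> [|u v]; first by exists [::]; [exact: derefs_to_nil | constructor].
move=> [_ [_ [-> [-> [_ [_ [-> [[r [-> Rr]] [_ [_ [-> [-> [_ [_ [-> [-> ->]]]]]]]]]]]]]]]].
move=> _ [t dt wt]; have [t' dt' wt'] := IH _ Rr.
exists (block_deref i t' ++ t).
  have := derefs_to_cat (derefs_to_block dt') dt.
  by rewrite /block /= -!catA.
rewrite letters_of_cat letters_of_block_deref.
exact: larsen_word_cat_block.
Qed.

Lemma Rlang_larsen_complete i w : larsen_word i.+1 w ->
  exists s t, [/\ Rlang (larsen i) s, derefs_to i s t & letters_of t = w].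
Proof.
elim: i w => [|i IH] w.
  (* Induction on the derivation needs a variable index; the equation [z = 0] remembers its
     value. *)
  move: {1 3}0 (erefl 0) => z z0.
  move En: z.+1 => n Hw; elim: Hw En => {n w} [n _|n u v Hu _ Hv IHv [nz]].
    by exists [::], [::]; split; [constructor | exact: derefs_to_nil |].
  (* The only content at level 0 is the empty word, so the doubled content disappears and the three
     letters of the star body of [larsen 0] remain. *)
  move: Hu IHv; rewrite -nz z0 => /larsen_word0 -> /(_ erefl) [s [t [Rs dt <-]]].
  exists ([:: XChr (a_l 0); XChr (a_m 0); XChr (a_r 0)] ++ s).
  exists ([:: XChr (a_l 0); XChr (a_m 0); XChr (a_r 0)] ++ t).
  split=> //.
    apply: star_cons Rs; exists [:: XChr (a_l 0)], [:: XChr (a_m 0); XChr (a_r 0)].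
    by split=> //; split=> //; exists [:: XChr (a_m 0)], [:: XChr (a_r 0)].
  apply: derefs_to_cat dt; split=> // pre rest /=.
  by rewrite -!cats1 -!catA.
move En: i.+2 => n Hw; elim: Hw En => {n w} [n _|n u v Hu _ Hv IHv [nz]].
  by exists [::], [::]; split; [constructor | exact: derefs_to_nil |].
move: Hu IHv; rewrite -nz => /IH [r [r' [Rr dr <-]]] /(_ erefl) [s [t [Rs dt <-]]].
exists (block i r ++ s), (block_deref i r' ++ t); split.
- apply: star_cons Rs; exists [:: XChr (a_l i.+1)], (behead (block i r)).
  do 2!split=> //; exists (XOpen i :: r ++ [:: XClose i]).
  exists [:: XChr (a_m i.+1); XNum i; XChr (a_r i.+1)].
  split; first by rewrite /= -catA.
  split; first by exists r.
  exists [:: XChr (a_m i.+1)], [:: XNum i; XChr (a_r i.+1)]; do 2!split=> //.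
  by exists [:: XNum i], [:: XChr (a_r i.+1)].
- exact: derefs_to_cat (derefs_to_block dr) dt.
by rewrite letters_of_cat letters_of_block_deref /= -!catA /= -!catA.
Qed.

Lemma Lrewb_larsen i w : Lrewb (larsen i) w <-> larsen_word i.+1 w.
Proof.
split=> [[s [/Rlang_larsen_sound [t [dt _] wt]]] | /Rlang_larsen_complete].
  by have := dt [::] [::]; rewrite cats0 /deref => -> [<-].
move=> [s [t [Rs [dt _] <-]]]; exists s; split=> //.
by have := dt [::] [::]; rewrite cats0.
Qed.

(** * Lists of transitions and elementary stack actions *)

Lemma In_map_filter (T U : Type) (f : T -> U) (P : pred T) (r : seq T) y :
  List.In y [seq f x | x <- r & P x] <-> exists x, [/\ List.In x r, P x & y = f x].
Proof.
elim: r => [|x r IH] /=; first by split=> // -[? []].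
case: ifP => Px /=; rewrite IH; split.
- case=> [<-|[z [rz Pz ->]]]; first by exists x; split=> //; left.
  by exists z; split=> //; right.
- by case=> z [[<-|rz] Pz ->]; [left | right; exists z].
- by case=> z [rz Pz ->]; exists z; split=> //; right.
by case=> z [[<-|rz] Pz ->]; [rewrite Px in Pz | exists z].
Qed.

Lemma In_cat (T : Type) (y : T) r1 r2 :
  List.In y (r1 ++ r2) <-> List.In y r1 \/ List.In y r2.
Proof. exact: List.in_app_iff. Qed.

Lemma In_mem (T : eqType) (y : T) r : y \in r <-> List.In y r.
Proof.
elim: r => [|x r IH] //=; rewrite inE; split.
  by case/orP=> [/eqP ->|/IH]; [left | right].
by case=> [->|/IH ->]; rewrite ?eqxx ?orbT.
Qed.

Lemma read_at_size (G : Type) (s1 s2 : seq G) x p :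
  p = (size s1).+1 -> read_at (s1 ++ x :: s2) p = Some (SSym x).
Proof.
move=> ->; rewrite /read_at /= size_cat /= addnS eqSS ltn_eqF ?leq_addr //.
by rewrite onth_cat ltnn subnn.
Qed.

Lemma read_at_top (G : Type) (s : seq G) : read_at s (size s).+1 = Some STop.
Proof. by rewrite /read_at /= eqxx. Qed.

Lemma read_at_last (G : Type) (z : G) s :
  read_at (z :: s) (size s).+1 = Some (SSym (last z s)).
Proof. by rewrite lastI -cats1; apply: read_at_size; rewrite size_belast. Qed.

Lemma apply_push (G : Type) (z x : G) s :
  apply_action (z :: s) (size s).+1 (Repl [:: last z s; x])
  = Some (z :: rcons s x, (size (rcons s x)).+1).
Proof.
rewrite /= eqxx /=; have -> : take (size s) (z :: s) = belast z s.
  by rewrite lastI -cats1 take_size_cat ?size_belast.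
by rewrite -cat_rcons -lastI cats1.
Qed.

(** * Bracket words and their recognition by a bounded counter *)

Section Automaton.
Variable i : nat.

Let level : finType := 'I_i.+1.
Let bracket : finType := (level * bool)%type.
(** [None] is the initial stack symbol; it stays below all brackets and stops the rewinding. *)
Let sym : finType := option bracket.

(* [(j, false)] opens and [(j, true)] closes a pair of level [j]; the second
   word is what the traversal of the first one consumes. *)
Inductive skeleton : nat -> seq bracket -> seq (Sigma_le i) -> Prop :=
  | skeleton_nil n : skeleton n [::] [::]
  | skeleton_cons (j : level) e u e' u' :
      skeleton j e u -> skeleton j.+1 e' u' ->
      skeleton j.+1 ((j, false) :: e ++ (j, true) :: e')
                    ((j, tl) :: u ++ (j, tm) :: u ++ (j, tr) :: u').

Lemma skeleton_larsen_word n e u :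
  skeleton n e u -> larsen_word n (map (@emb_letter i) u).
Proof.
elim=> [m|j {}e {}u e' u' _ IH _ IH']; first exact: larsen_word_nil.
by rewrite /= !(map_cat, map_cons); apply: larsen_word_cons.
Qed.

Lemma larsen_word_skeleton n w : larsen_word n w -> n <= i.+1 ->
  exists e u, skeleton n e u /\ w = map (@emb_letter i) u.
Proof.
elim=> [m _|m u v _ IHu _ IHv lemi].
  by exists [::], [::]; split; first exact: skeleton_nil.
have [e [x [Se ->]]] := IHu (ltnW lemi); have [e' [y [Se' ->]]] := IHv lemi.
exists ((Ordinal lemi, false) :: e ++ (Ordinal lemi, true) :: e').
exists ((Ordinal lemi, tl) :: x ++ (Ordinal lemi, tm) :: x ++ (Ordinal lemi, tr) :: y).
split; first exact: (@skeleton_cons (Ordinal lemi)).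
by rewrite /= !(map_cat, map_cons).
Qed.

Lemma skeleton_lt n e u x : skeleton n e u -> x \in e -> x.1 < n.
Proof.
elim=> [//|j {}e {}u e' u' _ IH _ IH'].
rewrite inE mem_cat inE => /or3P[/eqP -> //|/IH /ltnW //|].
by case/orP=> [/eqP -> //|/IH'].
Qed.

(* The number of levels still available just before resp. after reading a
   bracket: reading [(j, false)] goes from [j.+1] to [j], reading [(j, true)]
   from [j] to [j.+1]. *)
Definition depth_before (x : bracket) : 'I_i.+2 :=
  if x.2 then widen_ord (leqnSn _) x.1 else lift ord0 x.1.
Definition depth_after (x : bracket) : 'I_i.+2 :=
  depth_before (x.1, ~~ x.2).

(** Directly nested pairs have consecutive levels, so the open pairs are those of levels [d], ...,
    [i]. The number [d] thus replaces a pushdown and fits into the finite control. *)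
Fixpoint balanced (d : 'I_i.+2) (e : seq bracket) : bool :=
  if e is x :: e' then (depth_before x == d) && balanced (depth_after x) e'
  else d == ord_max.

(** [e1] is the part before the first unmatched closing bracket. The induction is on the size
    because, after an opening bracket, it is applied both to the content and to what follows the
    matching closing bracket. *)
Lemma balanced_split d e : balanced d e ->
  exists e1 e2, [/\ e = e1 ++ e2, exists u, skeleton d e1 u
    & if e2 is x :: e3 then x.2 && balanced d e2 else d == ord_max].
Proof.
have [m] := ubnP (size e); elim: m d e => // m IH d [|[j b] e] /=; rewrite ltnS => lt_em.
  by move=> ->; exists [::], [::]; split=> //; exists [::]; constructor.
case: b => /andP[/eqP <- bal].
  exists [::], ((j, true) :: e); split=> //=; last by rewrite eqxx bal.
  by exists [::]; constructor.
have [e1 [[|[k c] e3] [De [u Su] /=]]] := IH _ _ lt_em bal.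
  (* Inside a pair of level [j] the depth is [j], less than [ord_max], so the word cannot end
     there. *)
  by move=> /eqP/(congr1 val)/= /eqP; rewrite /bump /= ltn_eqF.
case/and3P=> c1 /eqP Ek bal3; rewrite {}c1 in De Ek bal3.
(* Equal depths force the unmatched closing bracket to have the level of the opening one. *)
have {Ek} Ek : k = j by apply: val_inj; have := congr1 val Ek.
rewrite {}Ek in De bal3; have lt3 : size e3 < m.
  by apply: leq_ltn_trans lt_em; rewrite De size_cat /= addnS leqW ?leq_addl.
have [e4 [e5 [De3 [u4 Su4] He5]]] := IH _ _ lt3 bal3.
exists ((j, false) :: e1 ++ (j, true) :: e4), e5; split=> //.
  by rewrite De De3 /= -catA.
by eexists; apply: skeleton_cons Su Su4.
Qed.

Lemma balanced_skeleton e : balanced ord_max e -> exists u, skeleton i.+1 e u.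
Proof.
move=> /balanced_split[e1 [[|[j b] e2] [-> Se1]]]; first by rewrite cats0.
move=> /= /and3P[-> /eqP/(congr1 val)/= jE _].
(* An unmatched closing bracket at full depth would have level [i.+1], which does not exist. *)
by have := ltn_ord j; rewrite jE ltnn.
Qed.

(** The suffix [e2] is there for the induction: the content of a pair is followed by its closing
    bracket and the rest of the word. *)
Lemma balanced_cat n e u : skeleton n e u -> forall (d : 'I_i.+2) e2,
  d = n :> nat -> balanced d e2 -> balanced d (e ++ e2).
Proof.
elim=> [//|j {}e {}u e' u' _ IH _ IH'] d e2 dE bal /=.
have Dd : depth_before (j, false) = d by apply: val_inj; exact: esym dE.
rewrite Dd eqxx /= -catA; apply: IH => //=; rewrite eqxx /=.
by apply: IH' => //; rewrite -[depth_after _]/(depth_before (j, false)) Dd.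
Qed.

Lemma skeleton_balanced e u : skeleton i.+1 e u -> balanced ord_max e.
Proof. by move=> /balanced_cat bal; rewrite -[e]cats0 bal /=. Qed.

(** * The automaton *)

(* In [Run b] and [Back j b], [b] is the set of levels whose current pair is
   being traversed for the second time. *)
Inductive state :=
  | Guess of 'I_i.+2
  | Rewind
  | Run of {set level}
  | Back of level & {set level}
  | Done.

Definition code_state (q : state) :=
  match q with
  | Guess d => inl (inl d)
  | Rewind => inl (inr false)
  | Done => inl (inr true)
  | Run b => inr (None, b)
  | Back j b => inr (Some j, b)
  end.
Definition decode_state (c : 'I_i.+2 + bool + option level * {set level}) :=
  match c with
  | inl (inl d) => Guess d
  | inl (inr false) => Rewind
  | inl (inr true) => Done
  | inr (None, b) => Run b
  | inr (Some j, b) => Back j b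
  end.
Lemma code_stateK : cancel code_state decode_state.
Proof. by case. Qed.
HB.instance Definition _ := Finite.copy state (can_type code_stateK).

Let transition := (option (Sigma_le i) * (state * saction sym))%type.

(** Only [Guess] pushes or offers a choice, and it can be left only when every pair is closed.
    Closing a pair clears its bit, so that the next pair of the same level starts afresh. *)
Definition transitions (q : state) (X : stsym sym) : seq transition :=
  match q, X with
  | Guess d, SSym Z =>
      [seq (None, (Guess (depth_after x), Repl [:: Z; Some x]))
         | x <- enum bracket & depth_before x == d]
      ++ nseq (d == ord_max) (None, (Rewind, Stay))
  | Rewind, SSym None => [:: (None, (Run set0, MoveR))]
  | Rewind, SSym (Some _) => [:: (None, (Rewind, MoveL))]
  | Run b, SSym (Some (j, false)) => [:: (Some (j, tl), (Run b, MoveR))]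
  | Run b, SSym (Some (j, true)) =>
      if j \in b then [:: (Some (j, tr), (Run (b :\ j), MoveR))]
      else [:: (Some (j, tm), (Back j b, MoveL))]
  | Run b, STop => [:: (None, (Done, Stay))]
  | Back j b, SSym (Some x) =>
      if x == (j, false) then [:: (None, (Run (j |: b), MoveR))]
      else [:: (None, (Back j b, MoveL))]
  | _, _ => [::]
  end.

Definition larsen_sa : stack_automaton (Sigma_le i) :=
  @SA (Sigma_le i) state sym (Guess ord_max) None
      (fun q => q == Done)
      (fun q a X => [seq t.2 | t <- transitions q X & t.1 == a]).

Lemma delta_larsen_sa q a X q' act :
  List.In (q', act) (sa_delta (s := larsen_sa) q a X) <->
  List.In (a, (q', act)) (transitions q X).
Proof.
rewrite In_map_filter; split=> [[[a' x] [Hx /eqP /= <- ->]] //|Hx].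
by exists (a, (q', act)); split=> /=.
Qed.

Lemma larsen_sa_nonerasing : nonerasing larsen_sa.
Proof.
move=> q a Z q' w /delta_larsen_sa; case: q => [d||b|j b|] //=.
- rewrite In_cat => -[/In_map_filter[x [_ _ [_ _ ->]]]|]; first by exists [:: Some x].
  by case: eqP => //= _ [].
- by case: Z => [x|] /= -[].
- by case: Z => [[j []]|] //=; [case: ifP => _ /= [] | case].
by case: Z => [x|] //=; case: ifP => _ /= [].
Qed.

(** * Acceptance from a configuration, phase by phase *)

Definition accepting (c : sa_config larsen_sa) : Prop :=
  exists qf s p, sa_reach c (qf, [::], s, p) /\ sa_final (s := larsen_sa) qf.

(** [Done] is the only final state, so from any other state an accepting run has a first step.
    Stating this and the following lemmas as equivalences treats soundness and completeness at
    once. *)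
Lemma accepting_step q w s p X :
  read_at s p = Some X -> q != Done ->
  accepting (q, w, s, p) <->
  exists a q' act w' s' p', [/\ List.In (a, (q', act)) (transitions q X),
    consume a w w', apply_action s p act = Some (s', p')
    & accepting (q', w', s', p')].
Proof.
move=> rX /eqP qD; split.
  move=> [qf [sf [pf [R F]]]].
  inversion R as [c|c1 c2 c3 st R2]; subst; first by move/eqP: F.
  inversion st as [? ? ? ? a Y q' act w' s' p' rY D C A]; subst.
  move: rY; rewrite rX => -[EY]; rewrite -{}EY in D.
  exists a, q', act, w', s', p'; split=> //; first exact/delta_larsen_sa.
  by exists qf, sf, pf.
move=> [a [q' [act [w' [s' [p' [D C A [qf [sf [pf [R F]]]]]]]]]]].
exists qf, sf, pf; split=> //; apply: sa_trans R.
by apply: (SAStep rX _ C A); apply/delta_larsen_sa.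
Qed.

Lemma accepting_det q w s p X a q' act s' p' :
  read_at s p = Some X -> transitions q X = [:: (a, (q', act))] ->
  apply_action s p act = Some (s', p') ->
  accepting (q, w, s, p) <->
  exists2 w', consume a w w' & accepting (q', w', s', p').
Proof.
move=> rX tr A; rewrite (accepting_step w rX) ?tr; last by apply/eqP => qD; rewrite qD in tr.
split=> [[_ [_ [_ [w' [s2 [p2 [[[<- <- <-]|//] C]]]]]]]|[w' C acc]].
  by rewrite A => -[<- <-] acc; exists w'.
by exists a, q', act, w', s', p'; split=> //; left.
Qed.

Lemma accepting_eps q w s p X q' act s' p' :
  read_at s p = Some X -> transitions q X = [:: (None, (q', act))] ->
  apply_action s p act = Some (s', p') ->
  accepting (q, w, s, p) <-> accepting (q', w, s', p').
Proof.
move=> rX tr A; rewrite (accepting_det w rX tr A).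
by split=> [[w' /= ->]|]; last exists w.
Qed.

Lemma accepting_chr q w s p X x q' act s' p' :
  read_at s p = Some X -> transitions q X = [:: (Some x, (q', act))] ->
  apply_action s p act = Some (s', p') ->
  accepting (q, w, s, p) <->
  exists2 w', w = x :: w' & accepting (q', w', s', p').
Proof. exact: accepting_det. Qed.

Lemma accepting_Done w s p : accepting (Done, w, s, p) <-> w = [::].
Proof.
split=> [[qf [sf [pf [R _]]]]|->]; last first.
  by exists Done, s, p; split; [exact: sa_refl | exact: eqxx].
inversion R as [c|c1 c2 c3 st R2]; subst => //.
inversion st as [? ? ? ? a Y q' act w' s' p' rY D C A]; subst.
by move/delta_larsen_sa: D.
Qed.

(** Induction from the right end; [s2] absorbs the symbols already passed. Position 2 is just above
    the initial symbol. *)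
Lemma accepting_Rewind e s2 w :
  accepting (Rewind, w, None :: map Some e ++ s2, (size e).+1) <->
  accepting (Run set0, w, None :: map Some e ++ s2, 2).
Proof.
elim/last_ind: e s2 => [|e x IH] s2.
  by apply: accepting_eps; [exact: (@read_at_size _ [::]) | by [] | by []].
rewrite map_rcons -cats1 -catA size_rcons -IH.
apply: accepting_eps; first (by rewrite -cat_cons; apply: read_at_size; rewrite /= size_map); by [].
Qed.

(** As [e] has no opening bracket of level [j], the leftward search stops at the partner of the
    closing bracket, at position [(size s1).+1]. *)
Lemma accepting_Back j b s1 e s2 w : (j, false) \notin e ->
  let s := s1 ++ Some (j, false) :: map Some e ++ s2 in
  accepting (Back j b, w, s, (size s1 + size e).+1) <->
  accepting (Run (j |: b), w, s, (size s1).+2).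
Proof.
elim/last_ind: e s2 => [|e x IH] s2 /=.
  move=> _; apply: accepting_eps; first by apply: read_at_size; rewrite addn0.
    by rewrite /= eqxx.
  by rewrite /= addn0 size_cat /= addnS ltnS leq_addr.
rewrite mem_rcons inE negb_or eq_sym => /andP[jx je].
rewrite map_rcons -cats1 -catA size_rcons addnS -IH //.
apply: accepting_eps.
- rewrite -cat_cons catA; apply: read_at_size.
  by rewrite size_cat /= size_map addnS.
- by rewrite /= (negbTE jx).
by [].
Qed.

(** Induction on the bracket word. The content of a pair is walked over twice, with bit sets [b] and
    [j |: b], so the induction hypothesis for it must hold for every set free of the levels below
    [j]. The bits end as they began, which lets the run go on with the following pairs. *)
Lemma accepting_Run n e u : skeleton n e u ->
  forall (b : {set level}) s1 s2 w, (forall j : level, j < n -> j \notin b) ->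
  let s := s1 ++ map Some e ++ s2 in
  accepting (Run b, w, s, (size s1).+1) <->
  exists2 w', w = u ++ w' & accepting (Run b, w', s, (size s1 + size e).+1).
Proof.
elim=> [m|j {}e {}u e' u' Se IHe Se' IHe'] b s1 s2 w nb s.
  by rewrite addn0; split=> [|[w' ->]//]; exists w.
have jb : j \notin b by exact: nb.
have nb' (k : level) : k < j -> k \notin b by move=> /ltnW; exact: nb.
have nbj (k : level) : k < j -> k \notin j |: b.
  by move=> kj; rewrite in_setU1 negb_or nb' // andbT neq_ltn kj.
(* [l1] and [l2] are the parts of the stack up to and including the opening and the closing bracket;
   [s] is decomposed at each pointer position that is needed. *)
set l1 := rcons s1 (Some (j, false)).
set s3 := map Some e' ++ s2.
have sE : s = s1 ++ Some (j, false) :: map Some e ++ Some (j, true) :: s3.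
  by rewrite /s /s3 /= map_cat /= -catA.
have sE1 : s = l1 ++ map Some e ++ Some (j, true) :: s3.
  by rewrite sE /l1 cat_rcons.
set l2 := rcons (l1 ++ map Some e) (Some (j, true)).
have sE1' : s = (l1 ++ map Some e) ++ Some (j, true) :: s3 by rewrite -catA.
have sE2 : s = l2 ++ map Some e' ++ s2 by rewrite sE1' /l2 cat_rcons.
have size1 : size l1 = (size s1).+1 by rewrite size_rcons.
have size1' : (size l1 + size e).+1 = (size (l1 ++ map Some e)).+1.
  by rewrite size_cat size_map.
have size2 : size l2 = (size l1 + size e).+1 by rewrite size_rcons size_cat size_map.
have le1 : size l1 + size e < size s.
  by rewrite sE1' !size_cat size_map /= addnS ltnS leq_addr.
have le0 : size s1 < size s.
  by apply: leq_ltn_trans le1; rewrite size1 addSn ltnW // ltnS leq_addr.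
have open v : accepting (Run b, v, s, (size s1).+1) <->
    exists2 v', v = (j, tl) :: v' & accepting (Run b, v', s, (size l1).+1).
  apply: accepting_chr.
  - by rewrite sE; apply: read_at_size.
  - by [].
  by rewrite /= le0 size1.
have pass1 (b' : {set level}) v : (forall k : level, k < j -> k \notin b') ->
    accepting (Run b', v, s, (size l1).+1) <->
    exists2 v', v = u ++ v' & accepting (Run b', v', s, (size l1 + size e).+1).
  by move=> ?; rewrite sE1; apply: IHe.
have mid v : accepting (Run b, v, s, (size l1 + size e).+1) <->
    exists2 v', v = (j, tm) :: v' & accepting (Run (j |: b), v', s, (size l1).+1).
  rewrite (@accepting_chr _ _ _ _ (SSym (Some (j, true))) (j, tm)
             (Back j b) MoveL s (size l1 + size e)) //.
  (* After reading the middle letter, the pointer goes back to the opening bracket; [skeleton_lt]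
     keeps that bracket out of the content. *)
  - have back v' := @accepting_Back j b s1 e (Some (j, true) :: s3) v'.
    have je : (j, false) \notin e.
      by apply/negP => /(skeleton_lt Se); rewrite ltnn.
    split=> -[v' E acc]; exists v' => //; move: acc;
      rewrite sE size1 addSn; by [move/(back _ je) | move=> acc; apply/(back _ je)].
  - by rewrite sE1'; apply: read_at_size.
  by rewrite /= (negbTE jb).
have close v : accepting (Run (j |: b), v, s, (size l1 + size e).+1) <->
    exists2 v', v = (j, tr) :: v' & accepting (Run b, v', s, (size l2).+1).
  apply: accepting_chr.
  - by rewrite sE1'; apply: read_at_size.
  (* Since [j] is not in [b], removing it from [j |: b] gives back [b]. *)
  - by rewrite /= setU11 setU1K.
  by rewrite /= le1 size2.
have rest v : accepting (Run b, v, s, (size l2).+1) <->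
    exists2 v', v = u' ++ v' & accepting (Run b, v', s, (size l2 + size e').+1).
  by rewrite sE2; apply: IHe'.
have -> : (size s1 + size ((j, false) :: e ++ (j, true) :: e')).+1
          = (size l2 + size e').+1.
  by rewrite /= size_cat /= size2 size1 !(addnS, addSn) addnA.
split.
  case/open=> w1 -> /(pass1 _ _ nb')[w2 -> /mid[w3 -> /(pass1 _ _ nbj)[w4 -> ]]].
  case/close=> w5 -> /rest[v -> acc]; exists v => //.
  by rewrite /= -!catA /= -!catA.
case=> v -> acc; rewrite /= -!catA /= -!catA /=.
apply/open; eexists; first by [].
apply/(pass1 _ _ nb'); eexists; first by [].
apply/mid; eexists; first by [].
apply/(pass1 _ _ nbj); eexists; first by [].
apply/close; eexists; first by [].
by apply/rest; exists v.
Qed.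

(** Once the guess is over the run is deterministic, so the stack content determines the accepted
    input. *)
Lemma accepting_Rewind_skeleton e u w : skeleton i.+1 e u ->
  accepting (Rewind, w, None :: map Some e, (size e).+1) <-> w = u.
Proof.
move=> Se; have := accepting_Rewind e [::] w; rewrite cats0 => ->.
have := @accepting_Run _ _ _ Se set0 [:: None] [::] w.
rewrite cats0 /= => -> => [|j _]; last by rewrite in_set0.
have read_top : read_at (None :: map Some e) (size e).+2 = Some STop.
  by rewrite -(size_map Some e); apply: (read_at_top (None :: _)).
have top v : accepting (Run set0, v, None :: map Some e, (size e).+2) <-> v = [::].
  rewrite -(accepting_Done v (None :: map Some e) (size e).+2).
  apply: accepting_eps; first exact: read_top; by [].
rewrite add1n; split=> [[v -> /top ->]|->]; first by rewrite cats0.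
by exists [::]; [rewrite cats0 | apply/top].
Qed.

Lemma Guess_transition d Z a q act :
  List.In (a, (q, act)) (transitions (Guess d) (SSym Z)) <->
  (exists x, [/\ depth_before x = d, a = None, q = Guess (depth_after x)
                & act = Repl [:: Z; Some x]])
  \/ [/\ d = ord_max, a = None, q = Rewind & act = Stay].
Proof.
rewrite /= In_cat In_map_filter; split.
  case=> [[x [_ /eqP xd [-> -> ->]]]|]; first by left; exists x.
  by case: eqP => //= -> [[<- <- <-]|//]; right.
case=> [[x [<- -> -> ->]]|[-> -> -> ->]]; last by right; rewrite eqxx; left.
by left; exists x; rewrite eqxx; split=> //; apply/In_mem; rewrite mem_enum.
Qed.

(** [e0] is what has been pushed so far and [e] what is still to be pushed. One direction is by
    induction on the run, the other by induction on [e]. *)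
Lemma accepting_Guess d e0 w :
  accepting (Guess d, w, None :: map Some e0, (size e0).+1) <->
  exists2 e, balanced d e
    & accepting (Rewind, w, None :: map Some (e0 ++ e), (size (e0 ++ e)).+1).
Proof.
have read (e : seq bracket) : read_at (None :: map Some e) (size e).+1
    = Some (SSym (last None (map Some e))).
  by have := read_at_last None (map Some e); rewrite size_map.
have push (e : seq bracket) x :
    apply_action (None :: map Some e) (size e).+1
      (Repl [:: last None (map Some e); Some x])
    = Some (None :: map Some (rcons e x), (size (rcons e x)).+1).
  by have := apply_push None (Some x) (map Some e);
    rewrite size_map -map_rcons size_map.
split=> [[qf [s [p [R F]]]]|[e]].
  move Ec: (Guess d, w, _, _) R => c; move Ef: (qf, _, s, p) => cf R.
  elim: R d e0 w Ec Ef => {c cf} [_ d e0 w <- [Eq] | c c2 c3 st R2 IH d e0 w Ec Ef].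
    (* The empty run would end in a [Guess] state, which is not final. *)
    by rewrite Eq in F.
  move: st; rewrite -Ec => st.
  inversion st as [? ? ? ? a X q' act w' s' p' rX D C A]; subst.
  move: rX; rewrite read => -[EX]; rewrite -{}EX in D.
  move/delta_larsen_sa/Guess_transition: D C A R2 IH.
  case=> [[x [xd -> -> ->]]|[-> -> -> ->]] ->.
    rewrite push => -[<- <-] _ IH.
    have [e bal acc] := IH _ _ _ erefl erefl.
    by exists (x :: e); rewrite /= ?xd ?eqxx // -cat_rcons.
  move=> [<- <-] R2 _; exists [::]; rewrite /= ?eqxx // cats0.
  by exists qf, s, p.
elim: e d e0 => [|x e IH] d e0 /=.
  move=> /eqP dmax; rewrite cats0 => acc.
  apply/(accepting_step w (read e0)) => //.
  exists None, Rewind, Stay, w, (None :: map Some e0), (size e0).+1; split=> //.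
  by apply/Guess_transition; right.
move=> /andP[/eqP xd bal]; rewrite -cat_rcons => acc.
apply/(accepting_step w (read e0)) => //.
exists None, (Guess (depth_after x)), (Repl [:: last None (map Some e0); Some x]), w.
do 2!eexists; split; [|by []|exact: push|exact: IH bal acc].
by apply/Guess_transition; left; exists x.
Qed.

Lemma sa_accepts_larsen u :
  sa_accepts larsen_sa u <-> exists e, skeleton i.+1 e u.
Proof.
rewrite -[sa_accepts _ _]/(accepting (Guess ord_max, u, None :: map Some [::], 1)).
rewrite (accepting_Guess ord_max [::] u); split=> [[e /balanced_skeleton[v Sv]]|[e Se]].
  by move/(accepting_Rewind_skeleton _ Sv) => ->; exists e.
by exists e; [exact: skeleton_balanced Se | apply/(accepting_Rewind_skeleton _ Se)].
Qed.

End Automaton.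

Theorem theorem3 :
  forall i : nat, exists A : stack_automaton (Sigma_le i),
    nonerasing A /\
    (forall w : seq letter,
        Lrewb (larsen i) w <->
        exists u : seq (Sigma_le i), w = map (@emb_letter i) u /\ sa_accepts A u).
Proof.
move=> i; exists (larsen_sa i); split; first exact: larsen_sa_nonerasing.
move=> w; rewrite Lrewb_larsen; split.
  move=> /larsen_word_skeleton/(_ (leqnn _)) [e [u [Se ->]]]; exists u; split=> //.
  by apply/sa_accepts_larsen; exists e.
by move=> [u [-> /sa_accepts_larsen[e /skeleton_larsen_word]]].
Qed.
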